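(* Let $X_1,X_2,\dots$ be heavy-tailed real-valued random variables with common distribution $F$, where $\overline{F}(x)=1-F(x)>0$ for all $x\in\mathbb{R}$, and let $\tau$ be a nonnegative integer-valued random variable independent of the sequence $\{X_k,k\ge1\}$ with $E\tau<\infty$. Assume that for all $i\ne j$, $$\lim_{x\to\infty}\frac{P(X_i>x,\,X_j>x)}{\overline{F}(x)+\overline{F}(x)}=0.$$ Then $$\lim_{x\to\infty}\frac{P(X_{(\tau)}>x)}{\overline{F}(x)}=E\tau.$$
   Context: A random variable $X$ (or its distribution) is heavy-tailed if $E e^{\alpha X}=\infty$ for all $\alpha>0$. For $n\ge1$, $X_{(n)}=\max_{1\le k\le n}X_k$; $X_{(\tau)}$ is obtained by replacing $n$ by the random index $\tau$, with value $0$ when $\tau=0$. *)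

(* Defs.v *)
From HB Require Import structures.
From mathcomp Require Import all_boot all_order all_algebra.
From mathcomp Require Import all_classical all_reals all_analysis.

Set Implicit Arguments.
Unset Strict Implicit.
Unset Printing Implicit Defensive.

Import Order.TTheory GRing.Theory Num.Theory.
Import numFieldNormedType.Exports.

Local Open Scope classical_set_scope.
Local Open Scope ring_scope.

Definition heavy_tailed d (T : measurableType d) (R : realType)
    (P : probability T R) (Y : T -> R) : Prop :=
  forall a : R, 0 < a -> ('M_P Y a = +oo)%E.

Definition common_cdf d (T : measurableType d) (R : realType)
    (P : probability T R) (Y : nat -> {RV P >-> R}) (F : R -> R) : Prop :=
  forall k x, cdf (Y k) x = (F x)%:E.

Definition tail (R : realType) (F : R -> R) (x : R) : R := 1 - F x.

Definition sigma_of d d' (T : measurableType d) (T' : measurableType d')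
    (Y : T -> T') : set (set T) :=
  preimage_set_system setT Y measurable.

Definition sigma_of_seq d d' (T : measurableType d) (T' : measurableType d')
    (Y : nat -> T -> T') : set (set T) :=
  <<s \bigcup_k sigma_of (Y k) >>.

Definition indep_classes d (T : measurableType d) (R : realType)
    (P : probability T R) (G H : set (set T)) : Prop :=
  forall A B, G A -> H B -> (P (A `&` B) = P A * P B)%E.

Definition indep_of_seq d d' d'' (T : measurableType d)
    (T' : measurableType d') (T'' : measurableType d'') (R : realType)
    (P : probability T R) (Z : T -> T') (Y : nat -> T -> T'') : Prop :=
  indep_classes P (sigma_of Z) (sigma_of_seq Y).

(* Sequences are indexed from 0, so Y k is the (k+1)-st variable and the
   maximum of the first n variables ranges over the indices k < n. For n > 0,
   Y 0 w is one of these values and serves as the initial value of the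
   iterated maximum. *)
Definition max_first (T : Type) (R : realType) (Y : nat -> T -> R)
    (n : nat) (w : T) : R :=
  if n == 0%N then 0 else \big[Num.max/Y 0%N w]_(k < n) Y k w.

Definition random_max (T : Type) (R : realType) (Y : nat -> T -> R)
    (tau : T -> nat) (w : T) : R :=
  max_first Y (tau w) w.

(* Main.v *)
(* For x >= 0, conditioning on the value of tau writes
   P(X_(tau) > x) / tail F x as the series of P(tau = n) f_n(x), where
   f_n(x) = P(max of the first n variables > x) / tail F x. Inclusion-exclusion
   and the vanishing of the pairwise overlaps give f_n(x) --> n, while the union
   bound f_n(x) <= n dominates the series by that of n P(tau = n) = E tau. *)

Require Import Defs.
From HB Require Import structures.
From mathcomp Require Import all_boot all_order all_algebra.
From mathcomp Require Import all_classical all_reals all_analysis.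

Set Implicit Arguments.
Unset Strict Implicit.
Unset Printing Implicit Defensive.

Import Order.TTheory GRing.Theory Num.Theory.
Import numFieldNormedType.Exports.

Local Open Scope classical_set_scope.
Local Open Scope ring_scope.

(** Dominated convergence for series, along an arbitrary proper filter because the parameter here is
    a real tending to infinity. The dominating terms are the limits themselves, so the series can
    only approach its limit from below, and a lower bound on a finite head suffices. *)
Lemma cvg_nneseries_dominated (R : realType) (I : Type) (G : set_system I)
    {FG : ProperFilter G} (q : I -> nat -> R) (b : nat -> R) :
  (\forall x \near G, forall n, 0 <= q x n <= b n) ->
  (forall n, q x n @[x --> G] --> b n) ->
  (\sum_(0 <= n <oo) (b n)%:E < +oo)%E ->
  (\sum_(0 <= n <oo) (q x n)%:E)%E @[x --> G]
    --> (\sum_(0 <= n <oo) (b n)%:E)%E.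
Proof.
move=> qb qcvg boo.
have b0 n : 0 <= b n.
  by have /filter_ex[x /(_ n)/andP[q0 /(le_trans q0)]] := qb.
have b0E n : (0 <= (b n)%:E)%E by rewrite lee_fin.
set S := (\sum_(0 <= n <oo) (b n)%:E)%E in boo *.
have Sfin : S \is a fin_num by rewrite ge0_fin_numE // nneseries_ge0.
have qS : \forall x \near G, (\sum_(0 <= n <oo) (q x n)%:E <= S)%E.
  apply: filterS qb => x qb; apply: lee_nneseries => n.
    by move=> _ _; rewrite lee_fin; case/andP: (qb n).
  by move=> _; rewrite lee_fin; case/andP: (qb n).
have Qfin : \forall x \near G, (\sum_(0 <= n <oo) (q x n)%:E)%E \is a fin_num.
  apply: filterS2 qb qS => x qb qS; rewrite ge0_fin_numE.
    exact: le_lt_trans boo.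
  by apply: nneseries_ge0 => n _ _; rewrite lee_fin; case/andP: (qb n).
rewrite -(fineK Sfin); apply/fine_cvgP; split=> //.
apply/cvgrPdist_le => e e0.
(* One half of [e] pays for the tail of [b] beyond [N], the other for the error on the first [N]
   terms. *)
have e20 : 0 < e / 2 by rewrite divr_gt0.
have [N tailN] : exists N, (\sum_(N <= n <oo) (b n)%:E < (e / 2)%:E)%E.
  have /fine_cvgP[tfin tcvg] := nneseries_tail_cvg boo (fun k _ => b0E k).
  have : \forall N \near \oo, (\sum_(N <= n <oo) (b n)%:E < (e / 2)%:E)%E.
    apply: filterS2 tfin (cvgr_lt _ tcvg _ e20) => N Nfin /=.
    by rewrite -lte_fin fineK.
  by move/filter_ex.
have head : \sum_(n < N) q x n @[x --> G] --> \sum_(n < N) b n.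
  by apply: (cvg_big add_continuous) => n _.
have headN : \forall x \near G, \sum_(n < N) b n - e / 2 < \sum_(n < N) q x n.
  by apply: (cvgr_gt _ head); rewrite ltrBlDr ltrDl.
near=> x.
have Qx : (\sum_(0 <= n <oo) (q x n)%:E)%E \is a fin_num by near: x.
have qbx n : 0 <= q x n <= b n by move: n; near: x.
(* By domination the distance is the limit minus the series, so only an upper bound on [S] is left
   to prove. *)
rewrite ger0_norm ?subr_ge0; last by apply: fine_le => //; near: x.
rewrite -lee_fin EFinB !fineK // leeBlDl //.
have -> : S = (\sum_(n < N) (b n)%:E + \sum_(N <= n <oo) (b n)%:E)%E.
  by rewrite /S (nneseries_split _ N) ?add0n ?big_mkord.
have hQ : (\sum_(n < N) (q x n)%:E <= \sum_(0 <= n <oo) (q x n)%:E)%E.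
  rewrite -(big_mkord xpredT (fun n => (q x n)%:E)).
  by apply: nneseries_lim_ge => n _ _; rewrite lee_fin; case/andP: (qbx n).
have hN : (\sum_(n < N) (b n)%:E <= (e / 2)%:E + \sum_(n < N) (q x n)%:E)%E.
  rewrite !sumEFin -EFinD lee_fin addrC -lerBlDr ltW //.
  by near: x.
apply: le_trans (leeD hN (ltW tailN)) _.
rewrite addeAC -EFinD -splitr.
by rewrite addeC leeD2r.
Unshelve. all: by end_near.
Qed.

(** The fibres of [tau] partition the space, and [tau] is constant on each of them. *)
Lemma expectation_nat_series d (T : measurableType d) (R : realType)
    (P : probability T R) (tau : {RV P >-> nat}) :
  ('E_P[fun w => (tau w)%:R] =
   \sum_(0 <= n <oo) n%:R%:E * P (tau @^-1` [set n]))%E.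
Proof.
have mt n : measurable (tau @^-1` [set n]).
  by rewrite -[_ @^-1` _]setTI; exact: measurable_funP.
have cov : \bigcup_n (tau @^-1` [set n]) = setT.
  by apply/seteqP; split=> // w _; exists (tau w).
have triv : trivIset setT (fun n => tau @^-1` [set n]).
  by move=> i j _ _ [w []] /= <- <-.
transitivity (\int[P]_(w in \bigcup_n (tau @^-1` [set n])) (tau w)%:R%:E)%E.
  by rewrite unlock cov.
rewrite ge0_integral_bigcup //; last first.
  rewrite cov; apply/measurable_realfun.measurable_EFinP.
  exact: (measurableT_comp (f := fun n : nat => n%:R : R)).
apply: eq_eseriesr => n _.
rewrite -integral_cst //; apply: eq_integral => w.
by rewrite inE /= => <-.
Qed.

Lemma random_index_bigcup (T : Type) (tau : T -> nat) (B : nat -> set T) :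
  [set w | B (tau w) w] = \bigcup_n (tau @^-1` [set n] `&` B n).
Proof.
apply/seteqP; split=> [w Bw|w [n _ [/= <-]]] //.
by exists (tau w).
Qed.

Lemma probability_random_index d (T : measurableType d) (R : realType)
    (P : probability T R) (tau : {RV P >-> nat}) (B : nat -> set T) :
  (forall n, measurable (B n)) ->
  (forall n, P (tau @^-1` [set n] `&` B n) = P (tau @^-1` [set n]) * P (B n))%E ->
  (P [set w | B (tau w) w] =
   \sum_(0 <= n <oo) P (tau @^-1` [set n]) * P (B n))%E.
Proof.
move=> mB ind.
have mt n : measurable (tau @^-1` [set n]).
  by rewrite -[_ @^-1` _]setTI; exact: measurable_funP.
have mI n : measurable (tau @^-1` [set n] `&` B n) by exact: measurableI.
rewrite random_index_bigcup measure_semi_bigcup //.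
- by apply: eq_eseriesr => n _; exact: ind.
- by move=> i j _ _ [w [[/= <- _] [/= <- _]]].
- exact: bigcup_measurable.
Qed.

(** Induction on [n] with inclusion-exclusion for two sets only: adding [A x n] to the union
    contributes 1 to the ratio, minus an overlap that tends to 0. *)
Lemma cvg_probability_bigsetU d (T : measurableType d) (R : realType)
    (P : probability T R) (I : Type) (G : set_system I) {FG : Filter G}
    (A : I -> nat -> set T) (t : I -> R) :
  (forall x k, measurable (A x k)) ->
  (forall x, 0 < t x) ->
  (forall x k, P (A x k) = (t x)%:E) ->
  (forall i j, i != j -> fine (P (A x i `&` A x j)) / t x @[x --> G] --> (0 : R)) ->
  forall n,
    fine (P (\big[setU/set0]_(i < n) A x i)) / t x @[x --> G] --> (n%:R : R).
Proof.
move=> mA t0 PA pairs; elim=> [|n IHn].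
  apply: cvg_near_cst; apply: nearW => x.
  by rewrite big_ord0 measure0 mul0r.
pose B x := \big[setU/set0]_(i < n) A x i.
have mB x : measurable (B x) by exact: bigsetU_measurable.
(* Intersection distributes over the union, so Boole's inequality bounds the overlap by the [n]
   pairwise overlaps with [A x n]. *)
have overlap : fine (P (B x `&` A x n)) / t x @[x --> G] --> (0 : R).
  apply: (@squeeze_cvgr _ _ _ _ (fun=> 0 : R)
    (fun x => \sum_(i < n) fine (P (A x i `&` A x n)) / t x)).
  - apply: nearW => x; rewrite divr_ge0 ?(ltW (t0 x)) ?fine_ge0 //=.
    rewrite -mulr_suml ler_pM2r ?invr_gt0 // -lee_fin -sumEFin.
    rewrite fineK ?fin_num_measure //; last exact: measurableI.
    rewrite (eq_bigr (fun i : 'I_n => P (A x i `&` A x n))); last first.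
      by move=> i _; rewrite fineK ?fin_num_measure //; exact: measurableI.
    rewrite /B big_distrl /=.
    apply: (@Boole_inequality _ _ _ P (fun i => A x i `&` A x n)) => i _.
    exact: measurableI.
  - exact: cvg_cst.
  (* The limit 0 is rewritten as a sum of [n] zeros so that the sums converge term by term. *)
  - rewrite -[X in _ --> X](@big1 R 0 +%R 'I_n (index_enum _) xpredT (fun=> 0)) //.
    apply: (cvg_big add_continuous) => i _; apply: pairs.
    by rewrite neq_ltn ltn_ord.
have step x : fine (P (\big[setU/set0]_(i < n.+1) A x i)) / t x =
    fine (P (B x)) / t x + 1 - fine (P (B x `&` A x n)) / t x.
  rewrite big_ord_recr /= -/(B x) measureUfinl ?ltey_eq ?fin_num_measure //.
  have mI : measurable (B x `&` A x n) by exact: measurableI.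
  rewrite fineB ?fineD ?fin_numD ?fin_num_measure //.
  have -> : fine (P (A x n)) = t x by rewrite PA.
  by rewrite mulrBl mulrDl divff ?gt_eqF.
rewrite -natr1 -(subr0 (_ + 1)) (eq_cvg _ _ step).
by apply: cvgB => //; apply: cvgD => //; exact: cvg_cst.
Qed.

(** The sign condition serves the case [n = 0]: the maximum is then 0 and the union is empty. *)
Lemma gt_max_first (T : Type) (R : realType) (Y : nat -> T -> R) n x :
  0 <= x ->
  [set w | x < max_first Y n w] = \big[setU/set0]_(k < n) [set w | x < Y k w].
Proof.
move=> x0; rewrite /max_first; case: n => [|n] /=.
  by rewrite big_ord0; apply/seteqP; split=> w //=; rewrite ltNge x0.
rewrite -(bigcup_mkord n.+1 (fun k => [set w | x < Y k w])).
apply/seteqP; split=> w /=.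
(* If the initial value of the iterated maximum exceeds [x], index 0 is the witness. *)
- move=> /bigmax_gtP[xY|[i _ xY]]; first by exists 0%N.
  by exists (nat_of_ord i); first exact: ltn_ord.
- move=> [k /= kn xY]; apply/bigmax_gtP; right.
  by exists (Ordinal kn).
Qed.

Theorem theorem4p3 (d : measure_display) (T : measurableType d) (R : realType)
    (P : probability T R) (X : nat -> {RV P >-> R}) (F : R -> R)
    (tau : {RV P >-> nat})
    (X_heavy : forall k, heavy_tailed P (X k))
    (X_cdf : common_cdf X F)
    (F_tail : forall x, 0 < tail F x)
    (tau_indep : indep_of_seq P tau (fun k => X k : T -> R))
    (tau_mean : ('E_P[fun w => (tau w)%:R] < +oo)%E)
    (X_pairs : forall i j : nat, i != j ->
       fine (P [set w | x < X i w /\ x < X j w]) / (tail F x + tail F x)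
         @[x --> +oo] --> (0 : R)) :
  (fine (P [set w | x < random_max (fun k => X k : T -> R) tau w])
     / tail F x)%:E @[x --> +oo] --> 'E_P[fun w => (tau w)%:R]%E.
Proof.
pose A (x : R) k := [set w | x < X k w].
have AE x k : A x k = X k @^-1` `]x, +oo[.
  by apply/seteqP; split=> w /=; rewrite in_itv /= andbT.
have mA x k : measurable (A x k).
  by rewrite AE -[_ @^-1` _]setTI; exact: measurable_funP.
have PA x k : P (A x k) = (tail F x)%:E.
  rewrite AE -[LHS]/(ccdf (X k) x) ccdf_1_cdf X_cdf /tail.
  by rewrite EFinB.
pose B x n := \big[setU/set0]_(k < n) A x k.
have mB x n : measurable (B x n) by exact: bigsetU_measurable.
have mt n : measurable (tau @^-1` [set n]).
  by rewrite -[_ @^-1` _]setTI; exact: measurable_funP.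
have ind x n : (P (tau @^-1` [set n] `&` B x n) =
    P (tau @^-1` [set n]) * P (B x n))%E.
  apply: tau_indep.
    by exists [set n] => //; rewrite setTI.
  (* To lie in the sigma-algebra of the whole sequence, the finite union becomes a countable one,
     with empty sets at the indices from [n] on. *)
  rewrite /B -bigcup_mkord bigcup_mkcond.
  apply: sigma_algebra_bigcup => k; case: ifPn => _; last exact: sigma_algebra0.
  apply: sub_sigma_algebra; exists k => //; rewrite AE.
  by exists [set` `]x, +oo[] => //; rewrite setTI.
pose a n := fine (P (tau @^-1` [set n])).
pose f x n := fine (P (B x n)) / tail F x.
have fn n : f x n @[x --> +oo] --> (n%:R : R).
  apply: (@cvg_probability_bigsetU d T R P R (+oo)%R _ A (tail F)) => //.
  move=> i j ij.
  (* The denominator in [X_pairs] is twice the tail, hence the factor 2, harmless in a limit equal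
     to 0. *)
  have E x : fine (P (A x i `&` A x j)) / tail F x =
      2 * (fine (P [set w | x < X i w /\ x < X j w]) / (tail F x + tail F x)).
    have -> : tail F x + tail F x = 2 * tail F x by rewrite mulr_natl mulr2n.
    by rewrite invfM mulrCA mulVKf.
  have := cvgM (cvg_cst (2 : R)) (X_pairs i j ij).
  rewrite mulr0 (eq_cvg _ _ E); exact.
have Ex x : 0 <= x ->
    ((fine (P [set w | x < random_max (fun k => X k : T -> R) tau w])
     / tail F x)%:E = \sum_(0 <= n <oo) (a n * f x n)%:E)%E.
  move=> x0.
  have -> : [set w | x < random_max (fun k => X k : T -> R) tau w] =
      [set w | B x (tau w) w].
    have BE n : B x n = [set w | x < max_first (fun k => X k : T -> R) n w].
      by rewrite gt_max_first.
    by apply/seteqP; split=> w /=; rewrite BE.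
  have mE : measurable [set w | B x (tau w) w].
    rewrite random_index_bigcup; apply: bigcup_measurable => n _.
    exact: measurableI.
  have tx := F_tail x.
  rewrite EFinM fineK ?fin_num_measure // probability_random_index //.
  rewrite muleC -nneseriesZl.
    apply: eq_eseriesr => n _.
    rewrite /a /f EFinM fineK ?fin_num_measure // EFinM fineK ?fin_num_measure //.
    by rewrite muleCA; congr (_ * _)%E; rewrite muleC.
  by move=> n _; rewrite mule_ge0.
have Et : ('E_P[fun w => (tau w)%:R] = \sum_(0 <= n <oo) (a n * n%:R)%:E)%E.
  rewrite expectation_nat_series; apply: eq_eseriesr => n _.
  by rewrite EFinM /a fineK ?fin_num_measure // muleC.
(* Finiteness of the mean becomes summability of the dominating series. *)
rewrite Et in tau_mean *.
(* The series formula [Ex] is available for [x >= 0], which holds eventually. *)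
apply: (@cvg_trans _ ((\sum_(0 <= n <oo) (a n * f x n)%:E)%E @[x --> +oo])).
  apply: near_eq_cvg; near=> x; apply/esym/Ex; near: x.
  exact: nbhs_pinfty_ge.
apply: cvg_nneseries_dominated => //.
(* The union bound gives [f x n <= n] at every [x], so the domination holds everywhere. *)
- apply: nearW => x n.
  have a0 : 0 <= a n by exact: fine_ge0.
  have f0 : 0 <= f x n by rewrite divr_ge0 ?fine_ge0 // ltW.
  rewrite mulr_ge0 //= ler_wpM2l // ler_pdivrMr //.
  rewrite -lee_fin fineK ?fin_num_measure //.
  apply: le_trans (Boole_inequality P _) _ => [k _|]; first exact: mA.
  rewrite (eq_bigr (fun=> (tail F x)%:E)) => [|k _]; last exact: PA.
  by rewrite sumEFin sumr_const card_ord mulr_natl.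
- by move=> n; apply: cvgM => //; exact: cvg_cst.
Unshelve. all: by end_near.
Qed.
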